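(* There exist absolute constants $c>0$ and $n_0$ such that for all integers $n\ge n_0$ and $m$ with $n^{0.99}\le m\le n/6$ the following holds. There exists a probability distribution $\mathcal{D}$ over random variables (distributions) $\overline{X}$ on $\{0,1\}^n$, each of min-entropy at least $1.5m$, such that for every function $h\colon\{0,1\}^n\to\{0,1\}^m$ of sparsity at most $0.001\, n\log_2 m\log_2(2n/m)$, \[ \mathbb{E}_{\overline{X}\sim\mathcal{D}}\bigl[\,\mathrm{SD}\bigl(h(\overline{X}),U_m\bigr)\bigr]\ \ge\ 1-e^{-m^{c}}, \] where $U_m$ is uniform on $\{0,1\}^m$ and $\mathrm{SD}$ denotes statistical distance.
   Context: For $h\colon\{0,1\}^n\to\{0,1\}^m$, output $j$ depends on input $i$ if there exist $x,x'\in\{0,1\}^n$ differing only in coordinate $i$ with $h(x)_j\ne h(x')_j$. The sparsity of $h$ is the number of pairs $(i,j)$ such that output $j$ depends on input $i$; $h$ is $s$-sparse if its sparsity is at most $s$. The min-entropy of $X$ is $\min_x\log_2(1/\Pr[X=x])$. The statistical distance between $A,B$ on a finite set is $\frac12\sum_\omega|\Pr[A=\omega]-\Pr[B=\omega]|$. *)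

(* Defs.v *)
From mathcomp Require Import all_boot.
From Stdlib Require Import Reals.

Set Implicit Arguments.
Unset Strict Implicit.
Unset Printing Implicit Defensive.

Definition bv (n : nat) : finType := (n.-tuple bool : finType).

Definition Rsum (T : finType) (f : T -> R) : R := \big[Rplus/R0]_(x : T) f x.

Definition is_dist (T : finType) (p : T -> R) : Prop :=
  (forall x, (0 <= p x)%R) /\ Rsum p = 1%R.

Definition log2 (x : R) : R := (ln x / ln 2)%R.

(* min-entropy of p is at least k:  min_x log2(1/Pr[X=x]) >= k, where points
   of probability 0 contribute +infinity to the minimum. *)
Definition min_entropy_ge (T : finType) (p : T -> R) (k : R) : Prop :=
  forall x, (0 < p x)%R -> (k <= log2 (/ p x))%R.

Definition push (T U : finType) (h : T -> U) (p : T -> R) : U -> R :=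
  fun y => \big[Rplus/R0]_(x : T | h x == y) p x.

Definition SD (T : finType) (p q : T -> R) : R :=
  (/ 2 * Rsum (fun w => Rabs (p w - q w)))%R.

Definition unif (m : nat) : bv m -> R := fun _ => (/ 2 ^ m)%R.

Definition depends (n m : nat) (h : bv n -> bv m) (i : 'I_n) (j : 'I_m) : bool :=
  [exists x : bv n, exists x' : bv n,
     [&& [forall k : 'I_n, (k != i) ==> (tnth x k == tnth x' k)],
         tnth x i != tnth x' i &
         tnth (h x) j != tnth (h x') j]].

Definition sparsity (n m : nat) (h : bv n -> bv m) : nat :=
  #|[set p : 'I_n * 'I_m | depends h p.1 p.2]|.

(* Main.v *)
From HB Require Import structures.
Require Import Defs.
From mathcomp Require Import all_boot.
From Stdlib Require Import Reals Lra.

(** Put [l = log2 (2n/m)]. The source is [z xor e] with [z] uniform (the index of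
    the random source) and [e] i.i.d. Bernoulli noise of rate [q = 3.5 m / (n l)],
    conditioned on having typical weight; its min-entropy is about
    [q n log2 (1/q) > 1.5 m]. An output of in-degree [D] keeps its value under the
    noise with probability at least [(1 + (1-2q)^D) / 2]. The average in-degree is
    at most [0.001 (n/m) l log2 m], so [q] is small enough for [h z] and
    [h (z xor e)] to agree on [m/2 + m^0.97 / 2] coordinates in expectation.
    Inputs influencing more than [m^0.18] outputs spoil concentration, but they are
    so few that the test may guess the values of all of them; for every guess,
    McDiarmid's inequality applies to the remaining inputs. Hence [h (z xor e)]
    agrees with one of few strings determined by [z] on [m/2 + m^0.97 / 4]
    coordinates, which a uniform string almost never does. *)

Set Implicit Arguments.
Unset Strict Implicit.
Unset Printing Implicit Defensive.

Local Open Scope R_scope.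

(** * Finite sums of reals *)

Lemma RplusA : associative Rplus. Proof. by move=> x y z; ring. Qed.
Lemma RmultA : associative Rmult. Proof. by move=> x y z; ring. Qed.
Lemma RmultDl : left_distributive Rmult Rplus. Proof. by move=> x y z; ring. Qed.
Lemma RmultDr : right_distributive Rmult Rplus. Proof. by move=> x y z; ring. Qed.

HB.instance Definition _ := Monoid.isComLaw.Build R 0 Rplus RplusA Rplus_comm Rplus_0_l.
HB.instance Definition _ := Monoid.isComLaw.Build R 1 Rmult RmultA Rmult_comm Rmult_1_l.
HB.instance Definition _ := Monoid.isMulLaw.Build R 0 Rmult Rmult_0_l Rmult_0_r.
HB.instance Definition _ := Monoid.isAddLaw.Build R Rmult Rplus RmultDl RmultDr.

Definition indR (b : bool) : R := if b then 1 else 0.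

Section Sums.
Variable T : finType.
Implicit Types f g : T -> R.

Lemma eq_Rsum f g : f =1 g -> Rsum f = Rsum g.
Proof. by move=> fg; apply: eq_bigr. Qed.

Lemma Rsum_le f g : (forall x, f x <= g x) -> Rsum f <= Rsum g.
Proof.
move=> fg; rewrite /Rsum; apply: (big_ind2 (fun x y => x <= y)) => //.
- by lra.
- by move=> *; lra.
Qed.

Lemma Rsum_ge0 f : (forall x, 0 <= f x) -> 0 <= Rsum f.
Proof. by move=> f0; apply: (big_ind (Rle 0)) => //; [lra | move=> *; lra]. Qed.

Lemma RsumD f g : Rsum (fun x => f x + g x) = Rsum f + Rsum g.
Proof. exact: big_split. Qed.

Lemma RsumZ a f : Rsum (fun x => a * f x) = a * Rsum f.
Proof. by rewrite /Rsum big_distrr. Qed.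

Lemma RsumB f g : Rsum (fun x => f x - g x) = Rsum f - Rsum g.
Proof.
have -> : Rsum f - Rsum g = Rsum f + -1 * Rsum g by ring.
by rewrite -RsumZ -RsumD; apply: eq_Rsum => x; ring.
Qed.

Lemma Rsum_const a : Rsum (fun _ : T => a) = INR #|T| * a.
Proof.
rewrite /Rsum big_const; elim: #|T| => [|k IH]; first by rewrite /=; ring.
by rewrite iterS IH S_INR; ring.
Qed.

Lemma Rsum_cond (P : pred T) f :
  \big[Rplus/R0]_(x | P x) f x = Rsum (fun x => indR (P x) * f x).
Proof.
rewrite /Rsum big_mkcond; apply: eq_bigr => x _; rewrite /indR.
by case: (P x); ring.
Qed.

Lemma Rsum_ind (P : pred T) : Rsum (fun x => indR (P x)) = INR #|P|.
Proof.
have -> : Rsum (fun x => indR (P x)) = Rsum (fun x => indR (P x) * 1).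
  by apply: eq_Rsum => x; ring.
rewrite -Rsum_cond big_const; elim: #|P| => [//|k IH].
by rewrite iterS IH S_INR; ring.
Qed.

Lemma Rabs_Rsum_le f : Rabs (Rsum f) <= Rsum (fun x => Rabs (f x)).
Proof.
apply: (big_ind2 (fun x y => Rabs x <= y)) => [|x y u v H1 H2|x _].
- by rewrite Rabs_R0; lra.
- by apply: Rle_trans (Rabs_triang _ _) _; lra.
- exact: Rle_refl.
Qed.

End Sums.

Lemma Rsum_exchange (S T : finType) (f : S -> T -> R) :
  Rsum (fun x => Rsum (f x)) = Rsum (fun y => Rsum (fun x => f x y)).
Proof. exact: exchange_big. Qed.

Lemma Rsum_bool (f : bool -> R) : Rsum f = f true + f false.
Proof. exact: big_bool. Qed.

Lemma Rsum_ordS n (f : 'I_n.+1 -> R) :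
  Rsum f = f ord0 + Rsum (fun i => f (lift ord0 i)).
Proof. exact: big_ord_recl. Qed.

Lemma Rsum_ord0 (f : 'I_0 -> R) : Rsum f = 0.
Proof. exact: big_ord0. Qed.

Lemma indR_ge0 b : 0 <= indR b. Proof. by case: b => /=; lra. Qed.
Lemma indR_le1 b : indR b <= 1. Proof. by case: b => /=; lra. Qed.

(** * Bit vectors and sums over the cube *)

Definition bcons n (a : bool) (t : bv n) : bv n.+1 := [tuple of a :: t].
Definition mkbv n (f : 'I_n -> bool) : bv n := [tuple f i | i < n].
Definition bxor n (x y : bv n) : bv n := mkbv (fun i => tnth x i (+) tnth y i).

Lemma tnth_mkbv n (f : 'I_n -> bool) i : tnth (mkbv f) i = f i.
Proof. exact: tnth_mktuple. Qed.

Lemma tnth_bxor n (x y : bv n) i : tnth (bxor x y) i = tnth x i (+) tnth y i.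
Proof. exact: tnth_mkbv. Qed.

Lemma tnth_bcons0 n a (t : bv n) : tnth (bcons a t) ord0 = a.
Proof. exact: tnth0. Qed.

Lemma tnth_bconsS n a (t : bv n) i : tnth (bcons a t) (lift ord0 i) = tnth t i.
Proof. exact: tnthS. Qed.

Lemma bv_eqP n (x y : bv n) : (forall i, tnth x i = tnth y i) -> x = y.
Proof. exact: eq_from_tnth. Qed.

Lemma bv0 (t : bv 0) : t = [tuple].
Proof. exact: tuple0. Qed.

Lemma bxor_bcons n a b (x y : bv n) :
  bxor (bcons a x) (bcons b y) = bcons (a (+) b) (bxor x y).
Proof.
apply: bv_eqP => i; rewrite tnth_bxor.
case: (unliftP ord0 i) => [j|] ->; first by rewrite !tnth_bconsS tnth_bxor.
by rewrite !tnth_bcons0.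
Qed.

Lemma bxorK n (z : bv n) : involutive (bxor z).
Proof. by move=> x; apply: bv_eqP => i; rewrite !tnth_bxor addKb. Qed.

Lemma Rsum_bxor n (z : bv n) (f : bv n -> R) :
  Rsum (fun x => f (bxor z x)) = Rsum f.
Proof. by rewrite [RHS]/Rsum (reindex_inj (inv_inj (@bxorK n z))). Qed.

Lemma Rsum_bv0 (f : bv 0 -> R) : Rsum f = f [tuple].
Proof.
rewrite /Rsum (eq_bigr (fun=> f [tuple])); last by move=> t _; rewrite (bv0 t).
by rewrite big_const (eq_card (B := predT)) // card_tuple /= Rplus_0_r.
Qed.

Lemma Rsum_bvS n (f : bv n.+1 -> R) :
  Rsum f = Rsum (fun a => Rsum (fun t => f (bcons a t))).
Proof.
rewrite /Rsum pair_big /=.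
rewrite (reindex (fun p : bool * bv n => bcons p.1 p.2)) //=.
exists (fun t : bv n.+1 => (thead t, [tuple of behead t])) => [[a t] _ | t _] /=.
  by congr pair; apply: val_inj.
by rewrite [RHS]tuple_eta.
Qed.

(** * Product measures on the cube and expectation *)

Definition pw (mu : bool -> R) n (t : bv n) : R :=
  \big[Rmult/R1]_(i < n) mu (tnth t i).

Definition Ex (mu : bool -> R) n (f : bv n -> R) : R :=
  Rsum (fun t => pw mu t * f t).

Lemma pw_bcons mu n a (t : bv n) : pw mu (bcons a t) = mu a * pw mu t.
Proof.
rewrite /pw big_ord_recl tnth_bcons0; congr (_ * _).
by apply: eq_bigr => i _; rewrite tnth_bconsS.
Qed.

Lemma Ex0 mu (f : bv 0 -> R) : Ex mu f = f [tuple].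
Proof. by rewrite /Ex Rsum_bv0 /pw big_ord0; ring. Qed.

Lemma ExS mu n (f : bv n.+1 -> R) :
  Ex mu f = mu true * Ex mu (fun t => f (bcons true t))
          + mu false * Ex mu (fun t => f (bcons false t)).
Proof.
rewrite /Ex Rsum_bvS Rsum_bool -!RsumZ.
by congr (_ + _); apply: eq_Rsum => t; rewrite pw_bcons; ring.
Qed.

Section Expectation.
Variable mu : bool -> R.
Hypothesis mu_ge0 : forall b, 0 <= mu b.
Hypothesis mu1 : mu true + mu false = 1.

Lemma pw_ge0 n (t : bv n) : 0 <= pw mu t.
Proof.
apply: (big_ind (Rle 0)) => [|x y Hx Hy|i _]; [lra| |exact: mu_ge0].
exact: Rmult_le_pos.
Qed.

Lemma eq_Ex n (f g : bv n -> R) : f =1 g -> Ex mu f = Ex mu g.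
Proof. by move=> fg; apply: eq_Rsum => t; rewrite fg. Qed.

Lemma ExD n (f g : bv n -> R) : Ex mu (fun t => f t + g t) = Ex mu f + Ex mu g.
Proof. by rewrite /Ex -RsumD; apply: eq_Rsum => t; ring. Qed.

Lemma ExZ n a (f : bv n -> R) : Ex mu (fun t => a * f t) = a * Ex mu f.
Proof. by rewrite /Ex -RsumZ; apply: eq_Rsum => t; ring. Qed.

Lemma Ex_const n a : Ex mu (fun _ : bv n => a) = a.
Proof.
elim: n => [|n IH]; first by rewrite Ex0.
by rewrite ExS IH -Rmult_plus_distr_r mu1; ring.
Qed.

Lemma Ex_le n (f g : bv n -> R) : (forall t, f t <= g t) -> Ex mu f <= Ex mu g.
Proof.
by move=> fg; apply: Rsum_le => t; apply: Rmult_le_compat_l => //; apply: pw_ge0.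
Qed.

Lemma Ex_Rsum (T : finType) n (f : T -> bv n -> R) :
  Ex mu (fun t => Rsum (fun x => f x t)) = Rsum (fun x => Ex mu (f x)).
Proof.
rewrite /Ex Rsum_exchange; apply: eq_Rsum => t; exact/esym/RsumZ.
Qed.

Lemma Ex_abs_diff n (f g : bv n -> R) c :
  (forall t, Rabs (f t - g t) <= c) -> Rabs (Ex mu f - Ex mu g) <= c.
Proof.
move=> fg; rewrite /Rminus.
have -> : Ex mu f + - Ex mu g = Ex mu (fun t => f t - g t).
  have -> : - Ex mu g = -1 * Ex mu g by ring.
  by rewrite -ExZ -ExD; apply: eq_Ex => t; ring.
rewrite -[c in _ <= c](Ex_const n c); apply: Rle_trans (Rabs_Rsum_le _) _.
apply: Rsum_le => t; rewrite Rabs_mult (Rabs_pos_eq _ (pw_ge0 t)).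
by apply: Rmult_le_compat_l => //; apply: pw_ge0.
Qed.

Lemma Ex_tnth n (f : bool -> R) (i : 'I_n) :
  Ex mu (fun t => f (tnth t i)) = mu true * f true + mu false * f false.
Proof.
elim: n i => [[]//|n IH] i; rewrite ExS.
case: (unliftP ord0 i) => [j|] ->.
  have E b : Ex mu (fun t => f (tnth (bcons b t) (lift ord0 j)))
      = mu true * f true + mu false * f false.
    by rewrite -(IH j); apply: eq_Ex => t; rewrite tnth_bconsS.
  by rewrite !E -Rmult_plus_distr_r mu1; ring.
rewrite (eq_Ex (g := fun t => f true)); last by move=> t; rewrite tnth_bcons0.
rewrite [X in _ + _ * X](eq_Ex (g := fun t => f false)); last by move=> t; rewrite tnth_bcons0.
by rewrite !Ex_const.
Qed.

End Expectation.

Arguments eq_Ex {mu n f g} _.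

Lemma Ex_exchange mu nu n k (f : bv n -> bv k -> R) :
  Ex mu (fun x => Ex nu (f x)) = Ex nu (fun y => Ex mu (fun x => f x y)).
Proof.
rewrite /Ex (eq_Rsum (g := fun x => Rsum (fun y => pw mu x * (pw nu y * f x y)))); last first.
  by move=> x; rewrite RsumZ.
rewrite Rsum_exchange; apply: eq_Rsum => y; rewrite -RsumZ.
by apply: eq_Rsum => x; ring.
Qed.

(** * Exponential inequalities and McDiarmid's inequality *)

Lemma exp_ge1D x : 1 + x <= exp x.
Proof.
case: (Req_dec x 0) => [->|x0]; first by rewrite exp_0; lra.
exact/Rlt_le/exp_ineq1.
Qed.

Lemma exp_le_inv x : x < 1 -> exp x <= / (1 - x).
Proof.
move=> x1; rewrite -[x in exp x]Ropp_involutive exp_Ropp.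
by apply: Rinv_le_contravar; [lra | have := exp_ge1D (- x); lra].
Qed.

(** For [x <= 0] the bound [/ (1 - x)] suffices because [(1 + x + x ^ 2) * (1 - x) = 1 - x ^ 3]; for
    [x > 0] that bound is too large, so it is applied to [x / 2] and squared. *)
Lemma exp_le_quad x : Rabs x <= / 4 -> exp x <= 1 + x + x ^ 2.
Proof.
move=> xb; have [xl xu] : - / 4 <= x <= / 4 by move: xb; rewrite /Rabs; case: Rcase_abs; lra.
case: (Rle_dec x 0) => x0.
  apply: Rle_trans (exp_le_inv _) _; first lra.
  apply: (Rmult_le_reg_r (1 - x)); first lra.
  by rewrite Rinv_l; [nra | lra].
have -> : x = x / 2 + x / 2 by field.
rewrite exp_plus; have E := @exp_le_inv (x / 2) ltac:(lra).
have y0 : 0 < / (1 - x / 2) by apply: Rinv_0_lt_compat; lra.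
have Ey := exp_pos (x / 2).
apply: (Rle_trans _ (/ (1 - x / 2) * / (1 - x / 2))); first by nra.
apply: (Rmult_le_reg_r ((1 - x / 2) * (1 - x / 2))); first by nra.
have -> : / (1 - x / 2) * / (1 - x / 2) * ((1 - x / 2) * (1 - x / 2)) = 1 by field; lra.
have -> : (1 + (x / 2 + x / 2) + (x / 2 + x / 2) ^ 2) * ((1 - x / 2) * (1 - x / 2))
   = 1 + x ^ 2 / 4 * (1 - 3 * x + x ^ 2) by field.
suff : 0 <= x ^ 2 / 4 * (1 - 3 * x + x ^ 2) by lra.
by apply: Rmult_le_pos; nra.
Qed.

Definition differ1 n (i : 'I_n) (x y : bv n) : Prop :=
  forall k, k != i -> tnth x k = tnth y k.

Section McDiarmid.
Variable mu : bool -> R.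
Hypothesis mu_ge0 : forall b, 0 <= mu b.
Hypothesis mu1 : mu true + mu false = 1.

(** Writing [u] and [v] as deviations from their mean makes the linear terms of [exp_le_quad]
    cancel; what remains is a variance, at most [c ^ 2]. *)
Lemma exp_moment_bool (u v lam c : R) :
  Rabs (u - v) <= c -> Rabs lam * c <= / 4 ->
  mu true * exp (lam * u) + mu false * exp (lam * v)
    <= exp (lam * (mu true * u + mu false * v) + lam ^ 2 * c ^ 2).
Proof.
move=> uv lc; have p0 := mu_ge0 true; have q0 := mu_ge0 false.
have c0 : 0 <= c by apply: Rle_trans (Rabs_pos _) uv.
have l0 := Rabs_pos lam.
set g := mu true * u + mu false * v; set d := u - v.
have -> : lam * u = lam * g + lam * (mu false * d).
  by rewrite /g /d; have -> : mu false = 1 - mu true; [lra | ring].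
have -> : lam * v = lam * g + lam * - (mu true * d).
  by rewrite /g /d; have -> : mu false = 1 - mu true; [lra | ring].
rewrite !exp_plus.
have bnd x : 0 <= x <= 1 -> Rabs (lam * (x * d)) <= / 4.
  move=> x01; rewrite !Rabs_mult (Rabs_pos_eq x); last lra.
  apply: Rle_trans lc; apply: Rmult_le_compat_l => //.
  by apply: Rle_trans uv; rewrite -/d; have := Rabs_pos d; nra.
have e1 := exp_le_quad (bnd (mu false) ltac:(lra)).
have e2 : exp (lam * - (mu true * d)) <= 1 + lam * - (mu true * d) + (lam * - (mu true * d)) ^ 2.
  apply: exp_le_quad; have -> : lam * - (mu true * d) = - (lam * (mu true * d)) by ring.
  by rewrite Rabs_Ropp; apply: bnd; lra.
have Eg := exp_pos (lam * g).
have d2 : d ^ 2 <= c ^ 2.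
  by rewrite -(pow2_abs d); apply: pow_incr; split => //; apply: Rabs_pos.
apply: (Rle_trans _ (exp (lam * g) * (1 + lam ^ 2 * c ^ 2))); last first.
  by apply: Rmult_le_compat_l; [lra | apply: exp_ge1D].
have -> : mu true * (exp (lam * g) * exp (lam * (mu false * d))) +
   mu false * (exp (lam * g) * exp (lam * - (mu true * d))) =
   exp (lam * g) * (mu true * exp (lam * (mu false * d)) + mu false * exp (lam * - (mu true * d))) by ring.
apply: Rmult_le_compat_l; first lra.
apply: (Rle_trans _ (1 + lam ^ 2 * d ^ 2)); last first.
  by have := pow2_ge_0 lam; nra.
apply: (Rle_trans _ (mu true * (1 + lam * (mu false * d) + (lam * (mu false * d)) ^ 2)
   + mu false * (1 + lam * - (mu true * d) + (lam * - (mu true * d)) ^ 2))).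
  by apply: Rplus_le_compat; apply: Rmult_le_compat_l.
have -> : mu true = 1 - mu false by lra.
have -> : (1 - mu false) * (1 + lam * (mu false * d) + (lam * (mu false * d)) ^ 2) +
 mu false * (1 + lam * - ((1 - mu false) * d) + (lam * - ((1 - mu false) * d)) ^ 2)
 = 1 + (lam ^ 2 * d ^ 2) * (mu false * (1 - mu false)) by ring.
have : 0 <= lam ^ 2 * d ^ 2 by apply: Rmult_le_pos; apply: pow2_ge_0.
have : mu false * (1 - mu false) <= 1 by nra.
by nra.
Qed.

(** Induction on the coordinates replaces the martingale: the two means conditional on the first bit
    differ by at most [c ord0], so [exp_moment_bool] treats that bit once the induction hypothesis
    has treated the others. *)
Lemma mcdiarmid n (f : bv n -> R) (c : 'I_n -> R) lam :
  (forall i x y, differ1 i x y -> Rabs (f x - f y) <= c i) ->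
  (forall i, Rabs lam * c i <= / 4) ->
  Ex mu (fun t => exp (lam * f t))
    <= exp (lam * Ex mu f + lam ^ 2 * Rsum (fun i => c i ^ 2)).
Proof.
elim: n f c => [|n IH] f c fc lc.
  by rewrite !Ex0 Rsum_ord0 Rmult_0_r Rplus_0_r; lra.
rewrite !ExS Rsum_ordS.
set C := Rsum _.
pose g b := Ex mu (fun t => f (bcons b t)).
have step b : Ex mu (fun t => exp (lam * f (bcons b t))) <= exp (lam * g b) * exp (lam ^ 2 * C).
  rewrite -exp_plus; apply: (IH (fun t => f (bcons b t)) (fun i => c (lift ord0 i))).
    move=> i x y xy; apply: fc => k.
    case: (unliftP ord0 k) => [j|] -> ki; last by rewrite !tnth_bcons0.
    by rewrite !tnth_bconsS; apply: xy; apply: contraNN ki => /eqP ->.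
  by move=> i; apply: lc.
apply: (Rle_trans _ ((mu true * exp (lam * g true) + mu false * exp (lam * g false)) * exp (lam ^ 2 * C))).
  rewrite Rmult_plus_distr_r (Rmult_assoc (mu true)) (Rmult_assoc (mu false)).
  by apply: Rplus_le_compat; (apply: Rmult_le_compat_l; [exact: mu_ge0 | exact: step]).
rewrite -/(g true) -/(g false) (Rmult_plus_distr_l (lam ^ 2)) -Rplus_assoc exp_plus.
apply: Rmult_le_compat_r; first exact/Rlt_le/exp_pos.
apply: exp_moment_bool => //.
apply: Ex_abs_diff => // t; apply: fc => k.
by case: (unliftP ord0 k) => [j|] ->; rewrite ?eqxx // !tnth_bconsS.
Qed.

End McDiarmid.

(** * Bernoulli noise and noise stability *)

Definition bern (q : R) (b : bool) : R := if b then q else 1 - q.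
Definition fair : bool -> R := bern (/ 2).

Lemma bern_ge0 q : 0 <= q <= 1 -> forall b, 0 <= bern q b.
Proof. by move=> q01 [] /=; lra. Qed.

Lemma bern1 q : bern q true + bern q false = 1.
Proof. by rewrite /=; ring. Qed.

Lemma fair_ge0 b : 0 <= fair b.
Proof. by apply: bern_ge0; lra. Qed.

Section Stability.
Variable q : R.
Hypothesis q0 : 0 <= q <= / 2.

(** The form [E [phi * T psi]] for the noise operator [T] of flip rate [q]; its bilinearity drives
    the induction in [noise_stability]. *)
Definition corr n (phi psi : bv n -> R) : R :=
  Ex fair (fun v => Ex (bern q) (fun e => phi v * psi (bxor v e))).

Lemma eq_corr n (f f' g g' : bv n -> R) : f =1 f' -> g =1 g' -> corr f g = corr f' g'.
Proof. by move=> ff gg; apply: eq_Ex => v; apply: eq_Ex => e; rewrite ff gg. Qed.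

Lemma corrDl n (f g h : bv n -> R) : corr (fun v => f v + g v) h = corr f h + corr g h.
Proof.
rewrite /corr -ExD; apply: eq_Ex => v; rewrite -ExD; apply: eq_Ex => e; ring.
Qed.

Lemma corrDr n (f g h : bv n -> R) : corr h (fun v => f v + g v) = corr h f + corr h g.
Proof.
rewrite /corr -ExD; apply: eq_Ex => v; rewrite -ExD; apply: eq_Ex => e; ring.
Qed.

Lemma corrZl n a (f h : bv n -> R) : corr (fun v => a * f v) h = a * corr f h.
Proof.
rewrite /corr -ExZ; apply: eq_Ex => v; rewrite -ExZ; apply: eq_Ex => e; ring.
Qed.

Lemma corrZr n a (f h : bv n -> R) : corr h (fun v => a * f v) = a * corr h f.
Proof.
rewrite /corr -ExZ; apply: eq_Ex => v; rewrite -ExZ; apply: eq_Ex => e; ring.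
Qed.

Lemma corrS n (f g : bv n.+1 -> R) :
  let f1 v := f (bcons true v) in let f0 v := f (bcons false v) in
  let g1 v := g (bcons true v) in let g0 v := g (bcons false v) in
  corr f g = / 2 * ((1 - q) * (corr f1 g1 + corr f0 g0) + q * (corr f1 g0 + corr f0 g1)).
Proof.
move=> f1 f0 g1 g0; rewrite /corr ExS.
have E b : Ex fair (fun t => Ex (bern q) (fun e => f (bcons b t) * g (bxor (bcons b t) e)))
  = q * corr (fun v => f (bcons b v)) (fun v => g (bcons (~~ b) v))
  + (1 - q) * corr (fun v => f (bcons b v)) (fun v => g (bcons b v)).
  rewrite /corr -!ExZ -ExD; apply: eq_Ex => v; rewrite ExS /=.
  by congr (_ * _ + _ * _); apply: eq_Ex => e; rewrite bxor_bcons ?addbT ?addbF.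
rewrite !E /corr /= /f1 /f0 /g1 /g0; field.
Qed.

(* Splitting off one coordinate, [corr phi phi] is the even part of [phi] plus
   [1 - 2q] times its odd part, so each relevant coordinate costs one factor [1 - 2q]. *)
Lemma noise_stability n (A : pred 'I_n) (phi : bv n -> R) :
  (forall x y, (forall i, A i -> tnth x i = tnth y i) -> phi x = phi y) ->
  (1 - 2 * q) ^ (\sum_(i < n) A i)%nat * Ex fair (fun v => phi v ^ 2) <= corr phi phi.
Proof.
elim: n A phi => [|n IH] A phi dep.
  rewrite big_ord0 pow_O Rmult_1_l; apply/Req_le/eq_Ex => v; rewrite Ex0.
  rewrite (_ : bxor v _ = v); first by ring.
  by rewrite [LHS]bv0 [RHS]bv0.
pose A' : pred 'I_n := fun i => A (lift ord0 i).
pose p1 v := phi (bcons true v); pose p0 v := phi (bcons false v).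
pose ev v := p1 v + p0 v; pose od v := p1 v + -1 * p0 v.
have depb b x y : (forall i, A' i -> tnth x i = tnth y i) -> phi (bcons b x) = phi (bcons b y).
  move=> xy; apply: dep => i; case: (unliftP ord0 i) => [j|] -> Ai; last by rewrite !tnth_bcons0.
  by rewrite !tnth_bconsS; apply: xy.
have dev x y : (forall i, A' i -> tnth x i = tnth y i) -> ev x = ev y.
  by move=> xy; rewrite /ev /p1 /p0 !(depb _ _ _ xy).
have dod x y : (forall i, A' i -> tnth x i = tnth y i) -> od x = od y.
  by move=> xy; rewrite /od /p1 /p0 !(depb _ _ _ xy).
have sq_ge0 (f : bv n -> R) : 0 <= Ex fair (fun v => f v ^ 2).
  rewrite -(Ex_const (bern1 (/2)) n 0); apply: Ex_le => [|v]; first exact: fair_ge0.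
  exact: pow2_ge_0.
have := sq_ge0 ev; have := IH A' ev dev; have := IH A' od dod.
rewrite corrS big_ord_recl -/p1 -/p0 ExS.
rewrite -[(\sum_(i < n) _)%nat]/(\sum_(i < n) A' i)%nat.
set D := (\sum_(i < n) A' i)%nat.
rewrite -[Ex fair (fun t => phi (bcons true t) ^ 2)]/(Ex fair (fun v => p1 v ^ 2)).
rewrite -[Ex fair (fun t => phi (bcons false t) ^ 2)]/(Ex fair (fun v => p0 v ^ 2)).
have -> : Ex fair (fun v => ev v ^ 2) =
  Ex fair (fun v => p1 v ^ 2) + 2 * Ex fair (fun v => p1 v * p0 v) + Ex fair (fun v => p0 v ^ 2).
  by rewrite -ExZ -!ExD; apply: eq_Ex => v; rewrite /ev; ring.
have -> : Ex fair (fun v => od v ^ 2) =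
  Ex fair (fun v => p1 v ^ 2) + -2 * Ex fair (fun v => p1 v * p0 v) + Ex fair (fun v => p0 v ^ 2).
  by rewrite -ExZ -!ExD; apply: eq_Ex => v; rewrite /od; ring.
rewrite /od /ev !(corrDl, corrDr, corrZl, corrZr).
have : 0 <= (1 - 2 * q) ^ D by apply: pow_le; lra.
case A0 : (A ord0).
  have -> : (1 - 2 * q) ^ (true + D)%nat = (1 - 2 * q) * (1 - 2 * q) ^ D by [].
  rewrite /fair /bern.
  move: (Ex fair _) (Ex fair _) (Ex fair _) (pow _ D) => P PQ Q r r0.
  move: (corr p1 p1) (corr p1 p0) (corr p0 p1) (corr p0 p0) => c11 c10 c01 c00 Ho He E0.
  set ec := c11 + c10 + (c01 + c00) in He.
  set oc := c11 + _ + _ in Ho.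
  have ec0 : 0 <= ec by apply: Rle_trans He; apply: Rmult_le_pos.
  have -> : / 2 * ((1 - q) * (c11 + c00) + q * (c10 + c01)) = / 4 * (ec + (1 - 2 * q) * oc).
    by rewrite /ec /oc; field.
  by nra.
(* An irrelevant first coordinate makes the two restrictions equal: the odd part vanishes and no
   factor is lost. *)
have p10 : p1 =1 p0.
  move=> v; apply: dep => i; case: (unliftP ord0 i) => [j|] ->; last by rewrite A0.
  by rewrite !tnth_bconsS.
rewrite (eq_corr p10 p10) (eq_corr p10 (frefl p0)) (eq_corr (frefl p0) p10).
have -> : Ex fair (fun v => p1 v ^ 2) = Ex fair (fun v => p0 v ^ 2).
  by apply: eq_Ex => v; rewrite p10.
have -> : Ex fair (fun v => p1 v * p0 v) = Ex fair (fun v => p0 v ^ 2).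
  by apply: eq_Ex => v; rewrite p10; ring.
rewrite add0n /fair /bern.
move: (Ex fair _) (pow _ D) (corr p0 p0) => P r c; lra.
Qed.

End Stability.

(** * Agreement of output strings: mean and concentration *)

Definition leR (x y : R) : bool := if Rle_dec x y then true else false.

Lemma leRP x y : reflect (x <= y) (leR x y).
Proof. by rewrite /leR; case: Rle_dec => H; constructor. Qed.

Lemma exp_le x y : x <= y -> exp x <= exp y.
Proof. by case=> [xy|->]; [left; apply: exp_increasing | right]. Qed.

(** The pointwise form of Chernoff's bound: taking expectations reduces a tail to an exponential
    moment. *)
Lemma indR_leR_le_exp x y lam : 0 <= lam -> indR (leR x y) <= exp (lam * (y - x)).
Proof.
move=> l0; case: leRP => xy /=; last exact/Rlt_le/exp_pos.
by rewrite -exp_0; apply: exp_le; nra.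
Qed.

Lemma indR_nleR_le_exp x y lam : 0 <= lam -> indR (~~ leR x y) <= exp (lam * (x - y)).
Proof.
move=> l0; case: leRP => xy /=; first exact/Rlt_le/exp_pos.
by rewrite -exp_0; apply: exp_le; nra.
Qed.

Definition agree m (y y' : bv m) : R := Rsum (fun j => indR (tnth y j == tnth y' j)).

Lemma agree_lipschitz m (B : pred 'I_m) (x x' y y' : bv m) :
  (forall j, ~~ B j -> tnth x j = tnth y j /\ tnth x' j = tnth y' j) ->
  Rabs (agree x x' - agree y y') <= Rsum (fun j => indR (B j)).
Proof.
move=> HB; rewrite /agree -RsumB; apply: Rle_trans (Rabs_Rsum_le _) _.
apply: Rsum_le => j; case Bj: (B j) => /=.
  by apply: Rabs_le; case: eqP; case: eqP => * /=; lra.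
by case: (HB j) => [|-> ->]; rewrite ?Bj // Rminus_diag Rabs_R0; lra.
Qed.

(** An upper bound on the dependencies rather than the exact relation, so that it passes to
    functions with some inputs frozen, as in [test_miss]. *)
Definition relies n m (g : bv n -> bv m) (A : 'I_n -> 'I_m -> bool) : Prop :=
  forall j x y, (forall i, A i j -> tnth x i = tnth y i) -> tnth (g x) j = tnth (g y) j.

(** Since [depends] concerns single-bit changes, [x] is turned into [y] one coordinate at a time
    through the hybrids [hyb k]; each step either changes nothing or flips an input on which output
    [j] does not depend. *)
Lemma relies_depends n m (h : bv n -> bv m) : relies h (depends h).
Proof.
move=> j x y xy.
pose hyb k : bv n := mkbv (fun i : 'I_n => if (i < k)%nat then tnth y i else tnth x i).
have hyb0 : hyb 0%nat = x by apply: bv_eqP => i; rewrite tnth_mkbv.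
have hybn : hyb n = y by apply: bv_eqP => i; rewrite tnth_mkbv ltn_ord.
suff H k : (k <= n)%nat -> tnth (h (hyb k)) j = tnth (h x) j by rewrite -hybn H.
elim: k => [|k IH] kn; first by rewrite hyb0.
rewrite -IH; last exact: ltnW.
pose i := Ordinal kn.
have off l : l != i -> tnth (hyb k.+1) l = tnth (hyb k) l.
  move=> li; rewrite !tnth_mkbv ltnS leq_eqVlt.
  by have /negPf -> : (l : nat) != k by apply: contraNN li => /eqP lk; apply/eqP/val_inj.
have ati : tnth (hyb k) i = tnth x i by rewrite tnth_mkbv ltnn.
have ati' : tnth (hyb k.+1) i = tnth y i by rewrite tnth_mkbv ltnSn.
case D : (depends h i j).
  congr (tnth (h _) j); apply: bv_eqP => l.
  case: (eqVneq l i) => [->|/off //]; by rewrite ati ati' (xy _ D).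
case: (eqVneq (tnth x i) (tnth y i)) => [e|ne].
  congr (tnth (h _) j); apply: bv_eqP => l.
  by case: (eqVneq l i) => [->|/off //]; rewrite ati ati' e.
apply/eqP/negPn/negP => neq; move/negbT/negP: D; apply.
apply/existsP; exists (hyb k.+1); apply/existsP; exists (hyb k).
rewrite ati ati' eq_sym ne neq /= andbT; apply/forallP => l; apply/implyP => li.
by rewrite off.
Qed.

Definition sgn (b : bool) : R := if b then 1 else -1.

Lemma indR_eq_sgn a b : indR (a == b) = / 2 * (1 + sgn a * sgn b).
Proof. by case: a; case: b => /=; field. Qed.

Section LowDegree.
Variables (n m : nat) (q : R) (g : bv n -> bv m) (A : 'I_n -> 'I_m -> bool).
Hypothesis q0 : 0 <= q <= / 2.
Hypothesis gA : relies g A.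

Let q1 : 0 <= q <= 1. Proof. by lra. Qed.

Let F v e := agree (g v) (g (bxor v e)).
Let deg i := Rsum (fun j => indR (A i j)).

(** By [indR_eq_sgn], an output keeps its value with probability half of one plus the noise
    correlation of its sign; the sign squares to 1, so [noise_stability] bounds this correlation
    from below. *)
Lemma expected_agree :
  INR m / 2 + / 2 * Rsum (fun j => (1 - 2 * q) ^ (\sum_(i < n) A i j)%nat)
    <= Ex fair (fun v => Ex (bern q) (F v)).
Proof.
have -> : Ex fair (fun v => Ex (bern q) (F v)) =
  Rsum (fun j => / 2 * (1 + corr q (fun v => sgn (tnth (g v) j)) (fun v => sgn (tnth (g v) j)))).
  rewrite /F /agree (eq_Ex (g := fun v => Rsum (fun j => Ex (bern q)
     (fun e => indR (tnth (g v) j == tnth (g (bxor v e)) j))))); last first.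
    by move=> v; rewrite Ex_Rsum.
  rewrite Ex_Rsum; apply: eq_Rsum => j.
  have E1 : 1 = Ex fair (fun _ : bv n => 1) by rewrite Ex_const //; exact: bern1.
  rewrite {1}E1 /corr -ExD -ExZ; apply: eq_Ex => v /=.
  rewrite -{1}(Ex_const (bern1 q) n 1) -ExD -ExZ.
  by apply: eq_Ex => e; rewrite indR_eq_sgn.
rewrite RsumZ RsumD Rsum_const card_ord.
suff : Rsum (fun j => (1 - 2 * q) ^ (\sum_(i < n) A i j)%nat) <=
  Rsum (fun j => corr q (fun v => sgn (tnth (g v) j)) (fun v => sgn (tnth (g v) j))) by lra.
apply: Rsum_le => j.
have := @noise_stability q q0 n (fun i => A i j) (fun v => sgn (tnth (g v) j)).
rewrite (eq_Ex (g := fun=> 1)); last by move=> v; case: (tnth _ _) => /=; ring.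
rewrite Ex_const; last exact: bern1.
by rewrite Rmult_1_r; apply => x y xy; rewrite (gA xy).
Qed.

(** McDiarmid's inequality is used twice, for the noise [e] at fixed [v] and then for [v] in the
    average over [e]; both have Lipschitz constants [deg i], whence the factor 2. *)
Lemma agree_exp_moment lam :
  0 <= lam -> (forall i, lam * deg i <= / 4) ->
  Ex fair (fun v => Ex (bern q) (fun e => exp (- lam * F v e)))
   <= exp (- lam * Ex fair (fun v => Ex (bern q) (F v)) + 2 * lam ^ 2 * Rsum (fun i => deg i ^ 2)).
Proof.
move=> l0 ld; set C := Rsum _.
have ld' i : Rabs (- lam) * deg i <= / 4 by rewrite Rabs_Ropp Rabs_pos_eq.
have dg i j (x y : bv n) : differ1 i x y -> ~~ A i j -> tnth (g x) j = tnth (g y) j.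
  move=> xy nA; apply: gA => k Ak; apply: xy; apply: contraTneq Ak => ->; exact: nA.
have dx i (v w x y : bv n) : differ1 i v w -> differ1 i x y -> differ1 i (bxor v x) (bxor w y).
  by move=> vw xy k ki; rewrite !tnth_bxor vw // xy.
have Fe v i x y : differ1 i x y -> Rabs (F v x - F v y) <= deg i.
  move=> xy; apply: agree_lipschitz => j nA; split=> //.
  by apply: (dg i) => //; apply: dx => //.
have Fv e i x y : differ1 i x y -> Rabs (F x e - F y e) <= deg i.
  move=> xy; apply: agree_lipschitz => j nA; split; first exact: (dg i).
  by apply: (dg i) => //; apply: dx => //.
have b0 := bern_ge0 q1; have b1 := bern1 q; have h0 := fair_ge0; have h1 := bern1 (/2).
apply: (Rle_trans _ (Ex fair (fun v => exp (lam ^ 2 * C) * exp (- lam * Ex (bern q) (F v))))).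
  apply: Ex_le => // v.
  rewrite -exp_plus Rplus_comm (_ : lam ^ 2 = (- lam) ^ 2); last by ring.
  by apply: mcdiarmid => //; apply: Fe.
rewrite ExZ (_ : 2 * lam ^ 2 * C = lam ^ 2 * C + (- lam) ^ 2 * C); last by ring.
rewrite -Rplus_assoc (Rplus_comm _ (lam ^ 2 * C)) Rplus_assoc exp_plus.
apply: Rmult_le_compat_l; first exact/Rlt_le/exp_pos.
apply: mcdiarmid => // i x y xy.
by apply: Ex_abs_diff => // e; apply: Fv.
Qed.

Lemma low_degree_agree_tail lam t S :
  0 <= lam -> (forall i, lam * deg i <= / 4) ->
  S <= Rsum (fun j => (1 - 2 * q) ^ (\sum_(i < n) A i j)%nat) ->
  Ex fair (fun v => Ex (bern q) (fun e => indR (~~ leR (INR m / 2 + t) (F v e))))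
   <= exp (- lam * (S / 2 - t) + 2 * lam ^ 2 * Rsum (fun i => deg i ^ 2)).
Proof.
move=> l0 ld SS.
have b0 := bern_ge0 q1; have h0 := fair_ge0.
apply: (Rle_trans _ (Ex fair (fun v => Ex (bern q) (fun e =>
    exp (lam * (INR m / 2 + t)) * exp (- lam * F v e))))).
  apply: Ex_le => // v; apply: Ex_le => // e.
  apply: Rle_trans (indR_nleR_le_exp _ _ l0) _; rewrite -exp_plus; apply: exp_le; lra.
rewrite (eq_Ex (g := fun v => exp (lam * (INR m / 2 + t)) * Ex (bern q) (fun e => exp (- lam * F v e)))); last first.
  by move=> v; rewrite ExZ.
rewrite ExZ.
apply: Rle_trans (Rmult_le_compat_l _ _ _ (Rlt_le _ _ (exp_pos _)) (agree_exp_moment l0 ld)) _.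
rewrite -exp_plus; apply: exp_le; have := expected_agree; nra.
Qed.

End LowDegree.

(** The mean agreement with a fixed string is [m / 2] and each bit moves it by at most 1, so
    McDiarmid's inequality applies. *)
Lemma uniform_agree_tail m (u : bv m) theta t :
  0 <= theta <= / 4 ->
  Ex fair (fun y => indR (leR (INR m / 2 + t) (agree y u)))
    <= exp (theta ^ 2 * INR m - theta * t).
Proof.
move=> th; have h0 := fair_ge0; have h1 := bern1 (/ 2).
apply: (Rle_trans _ (Ex fair (fun y => exp (- (theta * (INR m / 2 + t))) * exp (theta * agree y u)))).
  apply: Ex_le => // y; apply: Rle_trans (indR_leR_le_exp _ _ (proj1 th)) _.
  by rewrite -exp_plus; apply: exp_le; lra.
rewrite ExZ.
have E : Ex fair (fun y => agree y u) = INR m / 2.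
  rewrite /agree Ex_Rsum (eq_Rsum (g := fun=> / 2)); first by rewrite Rsum_const card_ord; field.
  move=> j; rewrite (Ex_tnth h1 (fun b => indR (b == tnth u j))).
  by case: (tnth u j) => /=; field.
have M : Ex fair (fun y => exp (theta * agree y u))
   <= exp (theta * Ex fair (fun y => agree y u) + theta ^ 2 * Rsum (fun i : 'I_m => 1 ^ 2)).
  apply: mcdiarmid => // [i x y xy|i]; last by rewrite Rabs_pos_eq; lra.
  have -> : 1 = Rsum (fun j => indR (pred1 i j)) by rewrite Rsum_ind card1.
  by apply: agree_lipschitz => j ji; split => //; apply: xy.
apply: Rle_trans (Rmult_le_compat_l _ _ _ (Rlt_le _ _ (exp_pos _)) M) _.
rewrite -exp_plus; apply: exp_le; rewrite E Rsum_const card_ord; lra.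
Qed.

(** * Lower tail of the noise weight *)

Definition weight n (e : bv n) : R := Rsum (fun i => indR (tnth e i)).

(** McDiarmid's inequality gives the variance proxy [n] rather than [q * n]; the loss is harmless
    because [q ^ 2 * n] is large in the calibration. *)
Lemma weight_lower_tail n q theta a : 0 <= q <= 1 -> 0 <= theta <= / 4 ->
  Ex (bern q) (fun e : bv n => indR (~~ leR a (weight e)))
    <= exp (theta * (a - q * INR n) + theta ^ 2 * INR n).
Proof.
move=> q01 th; have h0 := bern_ge0 q01; have h1 := bern1 q.
apply: (Rle_trans _ (Ex (bern q) (fun e : bv n => exp (theta * a) * exp (- theta * weight e)))).
  apply: Ex_le => // y; apply: Rle_trans (indR_nleR_le_exp _ _ (proj1 th)) _.
  by rewrite -exp_plus; apply: exp_le; lra.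
rewrite ExZ.
have E : Ex (bern q) (@weight n) = q * INR n.
  rewrite /weight Ex_Rsum (eq_Rsum (g := fun=> q)); first by rewrite Rsum_const card_ord; ring.
  by move=> j; rewrite (Ex_tnth h1 indR) /=; ring.
have M : Ex (bern q) (fun e : bv n => exp (- theta * weight e))
   <= exp (- theta * Ex (bern q) (@weight n) + (- theta) ^ 2 * Rsum (fun i : 'I_n => 1 ^ 2)).
  apply: mcdiarmid => // [i x y xy|i]; last by rewrite Rabs_Ropp Rabs_pos_eq; lra.
  have -> : 1 = Rsum (fun j => indR (pred1 i j)) by rewrite Rsum_ind card1.
  rewrite /weight -RsumB; apply: Rle_trans (Rabs_Rsum_le _) _.
  apply: Rsum_le => j /=; case: (eqVneq j i) => [_|/xy ->] /=.
    by apply: Rabs_le; case: (tnth x j); case: (tnth y j) => /=; lra.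
  by rewrite Rminus_diag Rabs_R0; lra.
apply: Rle_trans (Rmult_le_compat_l _ _ _ (Rlt_le _ _ (exp_pos _)) M) _.
rewrite -exp_plus; apply: exp_le; rewrite E Rsum_const card_ord; lra.
Qed.

(** * Exponential lower bounds for powers and sums *)

Lemma one_sub_ge_exp x : 0 <= x <= / 2 -> exp (- (2 * x)) <= 1 - x.
Proof.
move=> x0; apply: (Rle_trans _ (/ (1 - - (2 * x)))); first by apply: exp_le_inv; lra.
apply: (Rmult_le_reg_r (1 - - (2 * x))); first lra.
by rewrite Rinv_l; [nra | lra].
Qed.

Lemma pow_ge_exp q k : 0 <= q <= / 4 -> exp (- (4 * q) * INR k) <= (1 - 2 * q) ^ k.
Proof.
move=> q0; elim: k => [|k IH]; first by rewrite Rmult_0_r exp_0 /=; lra.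
rewrite S_INR Rmult_plus_distr_l Rmult_1_r Rplus_comm exp_plus -tech_pow_Rmult.
apply: Rmult_le_compat => //; try exact/Rlt_le/exp_pos.
by rewrite (_ : - (4 * q) = - (2 * (2 * q))); [apply: one_sub_ge_exp; lra | ring].
Qed.

(* Jensen's inequality for [exp], from its tangent line at the mean [-a]. *)
Lemma sum_exp_ge m (x : 'I_m -> R) a :
  Rsum x <= INR m * a -> INR m * exp (- a) <= Rsum (fun j => exp (- x j)).
Proof.
move=> xa; have ea := exp_pos (- a).
apply: (Rle_trans _ (Rsum (fun j => exp (- a) * (1 + a) - exp (- a) * x j))).
  rewrite RsumB Rsum_const card_ord RsumZ; have := Rmult_le_compat_l _ _ _ (Rlt_le _ _ ea) xa; lra.
apply: Rsum_le => j.
have -> : - x j = - a + (a - x j) by ring.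
by rewrite exp_plus; have := exp_ge1D (a - x j); nra.
Qed.

(** * Resampling and shifting of inputs *)

Definition mix n (H : pred 'I_n) (a v : bv n) : bv n :=
  mkbv (fun i => if H i then tnth a i else tnth v i).

(** Under a product measure, two independent samples spliced coordinate by coordinate form a sample
    again; this allows conditioning on the inputs in [H]. *)
Lemma Ex_mix mu n (H : pred 'I_n) (f : bv n -> R) : mu true + mu false = 1 ->
  Ex mu (fun a => Ex mu (fun v => f (mix H a v))) = Ex mu f.
Proof.
move=> mu1; elim: n H f => [|n IH] H f.
  by rewrite !Ex0; congr f; apply: bv_eqP => -[].
pose H' : pred 'I_n := fun i => H (lift ord0 i).
have E b c a v : mix H (bcons b a) (bcons c v) = bcons (if H ord0 then b else c) (mix H' a v).
  apply: bv_eqP => i; rewrite tnth_mkbv.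
  by case: (unliftP ord0 i) => [j|] ->; rewrite ?tnth_bconsS ?tnth_mkbv ?tnth_bcons0.
have K b : Ex mu (fun a => Ex mu (fun v => f (mix H (bcons b a) v))) =
  mu true * Ex mu (fun v => f (bcons (if H ord0 then b else true) v))
  + mu false * Ex mu (fun v => f (bcons (if H ord0 then b else false) v)).
  rewrite -(IH H' (fun v => f (bcons (if H ord0 then b else true) v))).
  rewrite -(IH H' (fun v => f (bcons (if H ord0 then b else false) v))).
  rewrite -!ExZ -ExD; apply: eq_Ex => a; rewrite ExS.
  by congr (_ * _ + _ * _); apply: eq_Ex => v; rewrite E.
rewrite !ExS !K; case: (H ord0).
  rewrite -!Rmult_plus_distr_r mu1; ring.
rewrite -!Rmult_plus_distr_r mu1; ring.
Qed.

Lemma Ex_fair_bxor n (z : bv n) (f : bv n -> R) :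
  Ex fair (fun v => f (bxor z v)) = Ex fair f.
Proof.
have hc (t : bv n) : pw fair t = pw fair (bxor z t).
  by apply: eq_bigr => i _; rewrite /fair; case: (tnth _ i); case: (tnth _ i) => /=; lra.
rewrite /Ex -[RHS](Rsum_bxor z); apply: eq_Rsum => t; by rewrite hc.
Qed.

Lemma ln_mono x y : 0 < x -> x <= y -> ln x <= ln y.
Proof. by move=> x0 [xy|->]; [left; apply: ln_increasing | right]. Qed.

Definition outdeg n m (A : 'I_n -> 'I_m -> bool) (i : 'I_n) : R :=
  Rsum (fun j => indR (A i j)).

Lemma outdeg_ge0 n m (A : 'I_n -> 'I_m -> bool) i : 0 <= outdeg A i.
Proof. by apply: Rsum_ge0 => j; apply: indR_ge0. Qed.

Lemma pow_le_exponent x k l : 0 <= x <= 1 -> (k <= l)%nat -> x ^ l <= x ^ k.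
Proof.
move=> x01 /subnK <-; elim: (l - k)%nat => [|d IH]; first exact: Rle_refl.
rewrite addSn -tech_pow_Rmult; have : 0 <= x ^ (d + k) by apply: pow_le; lra.
by nra.
Qed.

(** * Uniform measure and statistical distance *)

Lemma pw_fair m (y : bv m) : pw fair y = / 2 ^ m.
Proof.
rewrite /pw (eq_bigr (fun=> / 2)); last by move=> i _; rewrite /fair; case: (tnth _ _) => /=; lra.
rewrite big_const card_ord -pow_inv.
by elim: m {y} => [|m IH] //=; rewrite IH.
Qed.

Lemma Ex_fair m (f : bv m -> R) : Ex fair f = Rsum (fun y => / 2 ^ m * f y).
Proof. by apply: eq_Rsum => y; rewrite pw_fair. Qed.

(** The signs [2 * indR (B x) - 1] pair with [p x - r x] to at most its absolute value, and equality
    of the total masses removes the constant part. *)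
Lemma SD_ge (T : finType) (p r : T -> R) (B : pred T) : Rsum p = Rsum r ->
  Rsum (fun x => indR (B x) * p x) - Rsum (fun x => indR (B x) * r x) <= SD p r.
Proof.
move=> pr; rewrite /SD.
suff : Rsum (fun x => (2 * indR (B x) - 1) * (p x - r x)) <= Rsum (fun x => Rabs (p x - r x)).
  have -> : Rsum (fun x => (2 * indR (B x) - 1) * (p x - r x)) =
    2 * (Rsum (fun x => indR (B x) * p x) - Rsum (fun x => indR (B x) * r x))
    - (Rsum p - Rsum r).
    by rewrite -!RsumB -RsumZ -RsumB; apply: eq_Rsum => x; ring.
  by rewrite pr; lra.
apply: Rsum_le => x; case: (B x) => /=.
  by have := Rle_abs (p x - r x); lra.
by have := Rle_abs (- (p x - r x)); rewrite Rabs_Ropp; lra.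
Qed.

Lemma Rsum_push (T U : finType) (h : T -> U) (p : T -> R) (f : U -> R) :
  Rsum (fun y => f y * push h p y) = Rsum (fun x => f (h x) * p x).
Proof.
rewrite (eq_Rsum (g := fun y => Rsum (fun x => indR (h x == y) * (f (h x) * p x)))); last first.
  move=> y; rewrite /push Rsum_cond -RsumZ; apply: eq_Rsum => x.
  by case: eqP => [->|_] /=; ring.
rewrite Rsum_exchange; apply: eq_Rsum => x.
rewrite -Rsum_cond (eq_bigl (pred1 (h x))) ?big_pred1_eq //.
Qed.

(** * The distinguishing test *)

Section Test.
Variables (n m : nat) (h : bv n -> bv m) (A : 'I_n -> 'I_m -> bool).
Variables (q Delta t : R).
Hypothesis hA : relies h A.
Hypothesis q0 : 0 <= q <= / 2.
Hypothesis Delta0 : 0 <= Delta.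

Definition heavy : {set 'I_n} := [set i | ~~ leR (outdeg A i) Delta].

(** A guess of the heavy bits is encoded as a subset of [heavy], so the union bound in [test_size]
    has [2 ^ #|heavy|] terms. *)
Definition test (z : bv n) (y : bv m) : bool :=
  [exists a : {set 'I_n}, (a \subset heavy) &&
    leR (INR m / 2 + t) (agree (h (mix (mem heavy) (mkbv (fun i => i \in a)) z)) y)].

Lemma card_heavy : Delta * INR #|heavy| <= Rsum (outdeg A).
Proof.
have -> : INR #|heavy| = Rsum (fun i => indR (i \in heavy)).
  by rewrite Rsum_ind; congr INR; apply: eq_card.
rewrite -RsumZ; apply: Rsum_le => i; rewrite inE.
have := outdeg_ge0 A i.
by case: leRP => /= H1 H2; lra.
Qed.

(* The coordinates of the noise on heavy inputs are absorbed by shifting [z],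
   which the test allows for; the remaining noise acts on light inputs only. *)
Lemma test_miss lam S : 0 <= lam -> lam * Delta <= / 4 ->
  S <= Rsum (fun j => (1 - 2 * q) ^ (\sum_(i < n) A i j)%nat) ->
  Ex fair (fun z => Ex (bern q) (fun e => indR (~~ test z (h (bxor z e)))))
    <= exp (- lam * (S / 2 - t) + 2 * lam ^ 2 * (Delta * Rsum (outdeg A))).
Proof.
move=> l0 lD SS.
have b0 : forall b, 0 <= bern q b by apply: bern_ge0; lra.
have f0 := fair_ge0; have f1 := bern1 (/ 2).
pose eH (e : bv n) := mkbv (fun i => (i \in heavy) && tnth e i).
pose eL (e : bv n) := mkbv (fun i => (i \notin heavy) && tnth e i).
pose f v e := indR (~~ leR (INR m / 2 + t) (agree (h v) (h (bxor v (eL e))))).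
apply: (Rle_trans _ (Ex fair (fun z => Ex (bern q) (fun e => f (bxor (eH e) z) e)))).
  apply: Ex_le => // z; apply: Ex_le => // e; rewrite /f.
  have -> : bxor (bxor (eH e) z) (eL e) = bxor z e.
    apply: bv_eqP => i; rewrite !tnth_bxor !tnth_mkbv.
    by case: (i \in heavy); case: (tnth z i); case: (tnth e i).
  case: (boolP (leR _ _)) => [H|_] /=; last exact: indR_le1.
  suff -> : test z (h (bxor z e)) by rewrite /=; lra.
  (* The correct guess consists of the heavy bits of [bxor z e]; splicing them into [z] gives
     exactly the shifted point [bxor (eH e) z]. *)
  apply/existsP; exists [set i in heavy | tnth (bxor z e) i]; apply/andP; split.
    by apply/subsetP => i; rewrite inE => /andP[].
  rewrite (_ : mix _ _ _ = bxor (eH e) z) //.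
  apply: bv_eqP => i; rewrite tnth_bxor !tnth_mkbv /=.
  have -> : (i \in [set l in heavy | tnth (bxor z e) l]) = (i \in heavy) && tnth (bxor z e) i.
    by rewrite in_set.
  by rewrite tnth_bxor; case: (i \in heavy); rewrite /= ?addbF // addbC.
(* For fixed [e], uniformity of [z] hides the shift by [eH e]. The uniform point is then resampled
   as a heavy part [a] and a light part [v], and the bound is proved for every fixed [a]. *)
rewrite Ex_exchange.
rewrite (eq_Ex (g := fun e => Ex fair (fun a => Ex fair (fun v => f (mix (mem heavy) a v) e)))); last first.
  move=> e; rewrite (Ex_fair_bxor (eH e) (fun v => f v e)).
  exact: esym (Ex_mix (mem heavy) (fun v => f v e) f1).
rewrite Ex_exchange.
rewrite -[X in _ <= X](Ex_const f1 n); apply: Ex_le => // a.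
rewrite Ex_exchange.
pose g v := h (mix (mem heavy) a v).
(* Freezing the heavy inputs caps the out-degrees at [Delta] and can only shrink in-degrees, so [S]
   remains a valid lower bound. *)
pose B i j := A i j && (i \notin heavy).
have gB : relies g B.
  move=> j x y xy; apply: hA => i Ai; rewrite !tnth_mkbv /=.
  by case: ifPn => // iH; apply: xy; rewrite /B Ai.
have degB i : 0 <= outdeg B i <= Delta /\ outdeg B i <= outdeg A i.
  split; first split; first exact: outdeg_ge0.
  - case: (boolP (i \in heavy)) => iH.
      rewrite /outdeg (eq_Rsum (g := fun=> 0)); last by move=> j; rewrite /B iH andbF.
      by rewrite Rsum_const; lra.
    have -> : outdeg B i = outdeg A i by apply: eq_Rsum => j; rewrite /B iH andbT.
    by move: iH; rewrite inE negbK => /leRP.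
  - by apply: Rsum_le => j; rewrite /B; case: (A i j); case: (i \notin heavy) => /=; lra.
have -> : Ex fair (fun v => Ex (bern q) (fun e => f (mix (mem heavy) a v) e)) =
  Ex fair (fun v => Ex (bern q) (fun e => indR (~~ leR (INR m / 2 + t) (agree (g v) (g (bxor v e)))))).
  apply: eq_Ex => v; apply: eq_Ex => e; rewrite /f /g.
  rewrite (_ : bxor (mix _ a v) (eL e) = mix (mem heavy) a (bxor v e)) //.
  apply: bv_eqP => i; rewrite !tnth_bxor !tnth_mkbv ?tnth_bxor /=.
  by case: (i \in heavy); rewrite /= ?addbF.
have lB i : lam * outdeg B i <= / 4.
  by apply: Rle_trans lD; apply: Rmult_le_compat_l => //; case: (degB i) => -[].
have SB : S <= Rsum (fun j => (1 - 2 * q) ^ (\sum_(i < n) B i j)%nat).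
  apply: Rle_trans SS _; apply: Rsum_le => j; apply: pow_le_exponent; first lra.
  by apply: leq_sum => i _; rewrite /B; case: (A i j); case: (i \notin heavy).
apply: Rle_trans (low_degree_agree_tail q0 gB t l0 lB SB) _.
apply: exp_le; apply: Rplus_le_compat_l; apply: Rmult_le_compat_l.
  by have := pow2_ge_0 lam; lra.
rewrite -RsumZ; apply: Rsum_le => i; rewrite -/(outdeg B i).
by case: (degB i) => -[? ?] ?; nra.
Qed.

(** A union bound over the guesses: for each of them the candidate string does not depend on [y],
    and [uniform_agree_tail] applies. *)
Lemma test_size theta z : 0 <= theta <= / 4 ->
  Rsum (fun y => indR (test z y) * @unif m y)
    <= 2 ^ #|heavy| * exp (theta ^ 2 * INR m - theta * t).
Proof.
move=> th; set g := exp _.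
rewrite (eq_Rsum (g := fun y => / 2 ^ m * indR (test z y))); last by move=> y; rewrite Rmult_comm.
rewrite -Ex_fair.
pose u (a : {set 'I_n}) := h (mix (mem heavy) (mkbv (fun i => i \in a)) z).
apply: (Rle_trans _ (Ex fair (fun y => Rsum (fun a : {set 'I_n} =>
   indR (a \subset heavy) * indR (leR (INR m / 2 + t) (agree y (u a))))))).
  apply: Ex_le => [|y]; first exact: fair_ge0.
  have pos (a : {set 'I_n}) : 0 <= indR (a \subset heavy) * indR (leR (INR m / 2 + t) (agree y (u a))).
    by apply: Rmult_le_pos; apply: indR_ge0.
  case: (boolP (test z y)) => [/existsP[a /andP[aH La]]|_] /=; last exact: Rsum_ge0.
  rewrite /Rsum (bigD1 a) //= aH; set r := \big[_/_]_(_ | _) _.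
  have r0 : 0 <= r.
    by rewrite /r Rsum_cond; apply: Rsum_ge0 => i; apply: Rmult_le_pos (indR_ge0 _) (pos i).
  have -> : agree y (u a) = agree (u a) y by apply: eq_Rsum => j; rewrite eq_sym.
  by rewrite /u La /=; lra.
rewrite Ex_Rsum.
apply: (Rle_trans _ (Rsum (fun a : {set 'I_n} => g * indR (a \subset heavy)))).
  apply: Rsum_le => a; rewrite ExZ Rmult_comm; apply: Rmult_le_compat_r (indR_ge0 _) _.
  exact: uniform_agree_tail.
rewrite RsumZ Rsum_ind -(eq_card (A := powerset heavy)) ?card_powerset; last first.
  by move=> a; rewrite inE.
rewrite Rmult_comm; apply: Rmult_le_compat_r; first exact/Rlt_le/exp_pos.
suff -> : INR (expn 2 #|heavy|) = 2 ^ #|heavy| by exact: Rle_refl.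
by elim: #|heavy| => [|k IH] //; rewrite expnS mult_INR IH.
Qed.

End Test.

(** * The random source and its mean statistical distance *)

Section Source.
Variables (n : nat) (q a : R).
Hypothesis q01 : 0 < q <= 1.

(** The normalising constant of the conditioned noise. Only a lower bound on the weight is imposed,
    the side that min-entropy needs. *)
Definition typical : R := Ex (bern q) (fun e : bv n => indR (leR a (weight e))).

Hypothesis typical_ge : / 2 <= typical.

(** The law of [z] xor the conditioned noise: the noise that leads from [z] to [x] is [bxor z x]. *)
Definition source (z x : bv n) : R :=
  / typical * (pw (bern q) (bxor z x) * indR (leR a (weight (bxor z x)))).

Let b0 b : 0 <= bern q b. Proof. by apply: bern_ge0; lra. Qed.

Let typV : 0 < / typical <= 2.
Proof.
split; first by apply: Rinv_0_lt_compat; lra.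
by rewrite -[2]Rinv_inv; apply: Rinv_le_contravar; lra.
Qed.

Lemma source_dist z : is_dist (source z).
Proof.
split=> [x|]; first by apply: Rmult_le_pos; [lra | apply: Rmult_le_pos (pw_ge0 b0 _) (indR_ge0 _)].
rewrite /source (Rsum_bxor z (fun e => / typical * (pw (bern q) e * indR (leR a (weight e))))) RsumZ.
rewrite -/(Ex (bern q) (fun e : bv n => indR (leR a (weight e)))) -/typical.
by rewrite Rinv_l; lra.
Qed.

(** A set bit has probability [q], a clear bit at most 1. *)
Lemma pw_bern_le (e : bv n) : pw (bern q) e <= exp (weight e * ln q).
Proof.
have -> : weight e * ln q = Rsum (fun i => indR (tnth e i) * ln q).
  by rewrite Rmult_comm -RsumZ; apply: eq_Rsum => i; rewrite Rmult_comm.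
suff [] : 0 <= pw (bern q) e /\ pw (bern q) e <= exp (Rsum (fun i => indR (tnth e i) * ln q)) by [].
apply: (big_ind2 (fun p s => 0 <= p /\ p <= exp s)) => [|p s p' s' [? ?] [? ?]|i _].
- by rewrite exp_0; lra.
- by rewrite exp_plus; split; [apply: Rmult_le_pos | apply: Rmult_le_compat].
- split; first exact: b0.
  case: (tnth e i) => /=; first by rewrite Rmult_1_l exp_ln; lra.
  by rewrite Rmult_0_l exp_0; lra.
Qed.

(** On the support the weight is at least [a], so the noise has probability at most [q ^ a];
    conditioning at most doubles it, which costs the one bit subtracted. *)
Lemma source_min_entropy z k : k <= a * log2 (/ q) - 1 -> min_entropy_ge (source z) k.
Proof.
move=> ka x; rewrite /source; set e := bxor z x.
case: leRP => /= [ae|_]; last by rewrite !Rmult_0_r; lra.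
rewrite Rmult_1_r => p0; apply: Rle_trans ka _.
have l2 : 0 < ln 2 by rewrite -ln_1; apply: ln_increasing; lra.
have lq : ln q <= 0 by rewrite -ln_1; apply: ln_mono; lra.
have ple : / typical * pw (bern q) e <= exp (ln 2 + a * ln q).
  rewrite exp_plus exp_ln; last lra.
  apply: Rmult_le_compat; [lra | exact: pw_ge0 | lra |].
  apply: Rle_trans (pw_bern_le e) _; apply: exp_le; nra.
rewrite /log2 !ln_Rinv //; last lra.
have := ln_mono p0 ple; rewrite ln_exp => H.
apply: (Rmult_le_reg_r (ln 2)) => //.
have -> : - ln (/ typical * pw (bern q) e) / ln 2 * ln 2 = - ln (/ typical * pw (bern q) e) by field; lra.
have -> : (a * (- ln q / ln 2) - 1) * ln 2 = - (a * ln q) - ln 2 by field; lra.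
lra.
Qed.

(** Conditioning on an event of probability at least one half at most doubles probabilities, so
    bounds for independent noise transfer to the source. *)
Lemma source_event_le z (B : pred (bv n)) :
  Rsum (fun x => indR (B x) * source z x) <= 2 * Ex (bern q) (fun e => indR (B (bxor z e))).
Proof.
rewrite /Ex -RsumZ -[X in X <= _](Rsum_bxor z); apply: Rsum_le => e; rewrite /source bxorK.
have p0 := pw_ge0 b0 e; have i1 := indR_le1 (leR a (weight e)); have i0 := indR_ge0 (leR a (weight e)).
have B0 := indR_ge0 (B (bxor z e)).
have : / typical * (pw (bern q) e * indR (leR a (weight e))) <= 2 * pw (bern q) e.
  apply: Rmult_le_compat; try lra; first exact: Rmult_le_pos.
  by rewrite -[X in _ <= X]Rmult_1_r; apply: Rmult_le_compat_l.
by move=> /(Rmult_le_compat_l _ _ _ B0); lra.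
Qed.

End Source.

(** For each [z] the event in [SD_ge] is acceptance by the test. Under the uniform measure
    [test_size] bounds it; rejection under the source is at most twice as likely as under
    unconditioned noise, which [test_miss] bounds on average over [z]. *)
Lemma mean_SD_ge n m (h : bv n -> bv m) A q a Delta t lam S theta :
  relies h A -> 0 < q <= / 2 -> / 2 <= typical n q a -> 0 <= Delta ->
  0 <= lam -> lam * Delta <= / 4 -> 0 <= theta <= / 4 ->
  S <= Rsum (fun j => (1 - 2 * q) ^ (\sum_(i < n) A i j)%nat) ->
  1 - 2 ^ #|heavy A Delta| * exp (theta ^ 2 * INR m - theta * t)
    - 2 * exp (- lam * (S / 2 - t) + 2 * lam ^ 2 * (Delta * Rsum (outdeg A)))
  <= Rsum (fun z => / 2 ^ n * SD (push h (source q a z)) (@unif m)).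
Proof.
move=> hA q0 typ D0 l0 lD th SS; set gam := _ * exp _; set bet := exp _.
have q0' : 0 <= q <= / 2 by lra.
have f1 := bern1 (/ 2).
have q1 : 0 < q <= 1 by lra.
rewrite -Ex_fair.
have := test_miss t hA q0' D0 l0 lD SS; rewrite -/bet => miss.
apply: (Rle_trans _ (Ex fair (fun z => (1 - gam) + -2 * Ex (bern q)
    (fun e => indR (~~ test h A Delta t z (h (bxor z e))))))).
  by rewrite ExD ExZ Ex_const //; lra.
apply: Ex_le => [|z]; first exact: fair_ge0.
have [s0 s1] := source_dist q1 typ z.
have u1 : Rsum (@unif m) = 1.
  rewrite -(Ex_const f1 m 1) Ex_fair; apply: eq_Rsum => y; rewrite /unif; lra.
have p1 : Rsum (push h (source q a z)) = 1.
  have -> : Rsum (push h (source q a z)) = Rsum (fun y => 1 * push h (source q a z) y).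
    by apply: eq_Rsum => y; rewrite Rmult_1_l.
  by rewrite (Rsum_push _ _ (fun=> 1)); apply: etrans s1; apply: eq_Rsum => x; rewrite Rmult_1_l.
apply: Rle_trans (SD_ge (test h A Delta t z) _); last by rewrite u1.
rewrite Rsum_push.
have sz := test_size h A Delta t z th; rewrite -/gam in sz.
have ev := source_event_le q1 typ z (fun x => ~~ test h A Delta t z (h x)).
have -> : Rsum (fun x => indR (test h A Delta t z (h x)) * source q a z x) =
   1 - Rsum (fun x => indR (~~ test h A Delta t z (h x)) * source q a z x).
  rewrite -[X in X - _]s1 -RsumB; apply: eq_Rsum => x; by case: (test _ _ _ _ _ _) => /=; ring.
lra.
Qed.

(** * Sparsity as a degree sum, and numerical calibration *)

Lemma Rsum_outdeg n m (h : bv n -> bv m) : Rsum (outdeg (depends h)) = INR (sparsity h).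
Proof.
rewrite /sparsity cardsE -Rsum_ind /outdeg /Rsum pair_big; exact: eq_bigr.
Qed.

Lemma INR_sum_bool n (A : pred 'I_n) : INR (\sum_(i < n) A i)%nat = Rsum (fun i => indR (A i)).
Proof.
elim: n A => [|n IH] A; first by rewrite big_ord0 Rsum_ord0.
by rewrite big_ord_recl plus_INR IH Rsum_ordS; case: (A ord0).
Qed.

Lemma Rsum_indeg n m (h : bv n -> bv m) :
  Rsum (fun j => INR (\sum_(i < n) depends h i j)%nat) = INR (sparsity h).
Proof.
rewrite -Rsum_outdeg /outdeg Rsum_exchange; apply: eq_Rsum => j; exact: INR_sum_bool.
Qed.

Lemma exp_pow y k : exp (INR k * y) = exp y ^ k.
Proof.
elim: k => [|k IH]; first by rewrite Rmult_0_l exp_0.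
by rewrite S_INR Rmult_plus_distr_r Rmult_1_l Rplus_comm exp_plus IH.
Qed.

Lemma exp_ge_cube y : 0 <= y -> y ^ 3 / 27 <= exp y.
Proof.
move=> y0; have -> : y = INR 3 * (y / 3) by rewrite /=; field.
rewrite exp_pow; have -> : (INR 3 * (y / 3)) ^ 3 / 27 = (y / 3) ^ 3 by rewrite /=; field.
by apply: pow_incr; have := exp_ge1D (y / 3); lra.
Qed.

Lemma ln2_bounds : / 2 < ln 2 <= 1.
Proof.
split; first exact: ln_lt_2.
rewrite -[X in _ <= X]ln_exp; apply: ln_mono; first lra.
by have := exp_ge1D 1; lra.
Qed.

Lemma exp_opp1_le : exp (- (1)) <= / 2.
Proof. by rewrite (_ : 2 = 1 - - (1)); [apply: exp_le_inv; lra | lra]. Qed.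

(* All quantities are compared with powers of [M = m^0.01]: the sparsity is at most
   [M^103], inputs of out-degree above [M^18] are heavy, hence at most [M^85] inputs
   are, and the excess agreement is [M^97 / 2]. *)
Section Calibration.
Variables (n m : nat).
Let y := ln (INR m) / 100.
Let M := exp y.
Let l := log2 (2 * INR n / INR m).
Let q := 7 / 2 * INR m / (INR n * l).

Hypothesis n_large : 210000 <= ln (INR n).
Hypothesis n_gt0 : 0 < INR n.
Hypothesis m_ge : Rpower (INR n) 0.99 <= INR m.
Hypothesis m_le : INR m <= INR n / 6.

Lemma m_gt0 : 0 < INR m.
Proof. by apply: Rlt_le_trans m_ge; apply: exp_pos. Qed.
Let m0 := m_gt0.

(** The hypothesis [m_ge] gives [0.99 * ln n <= 100 * y], and [100 / 0.99 < 102]. *)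
Lemma ln_n_le : ln (INR n) <= 102 * y.
Proof.
have : ln (Rpower (INR n) 0.99) <= ln (INR m) by apply: ln_mono => //; apply: exp_pos.
by rewrite /Rpower ln_exp /y; lra.
Qed.

Lemma y_ge : 2000 <= y.
Proof. by have := ln_n_le; lra. Qed.
Let yl := y_ge.

Lemma m_eq_pow : INR m = M ^ 100.
Proof.
rewrite /M -exp_pow (_ : INR 100 = 100); last by rewrite INR_IZR_INZ.
by rewrite /y (_ : 100 * (ln (INR m) / 100) = ln (INR m)); [rewrite exp_ln | field].
Qed.

Lemma M_ge : 2001 <= M.
Proof. by have := exp_ge1D y; rewrite /M; lra. Qed.
Let Ml := M_ge.

(** One power of [M] absorbs the logarithmic factors; 42 covers the constant
    [0.001 * 200 * 204 = 40.8] met in [sparsity_le_pow]. *)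
Lemma M_ge_sq : 42 * y ^ 2 <= M.
Proof. by apply: Rle_trans (exp_ge_cube _); [nra | lra]. Qed.

Lemma n_le_pow : INR n <= M ^ 102.
Proof.
rewrite -[INR n]exp_ln // /M -exp_pow; apply: exp_le.
by rewrite (_ : INR 102 = 102); [exact: ln_n_le | rewrite INR_IZR_INZ].
Qed.

Lemma log2_m_le : log2 (INR m) <= 200 * y.
Proof.
have [l1 l2] := ln2_bounds; rewrite /log2.
apply: (Rmult_le_reg_r (ln 2)); first lra.
rewrite (_ : ln (INR m) / ln 2 * ln 2 = 100 * y); last by rewrite /y; field; lra.
nra.
Qed.

(** From [m <= n / 6] the argument of the logarithm is at least 12, and [2 ^ 7 <= 12 ^ 2]. *)
Lemma l_ge : 7 / 2 <= l.
Proof.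
have [l1 l2] := ln2_bounds; rewrite /l /log2.
apply: (Rmult_le_reg_r (ln 2)); first lra.
rewrite (_ : ln (2 * INR n / INR m) / ln 2 * ln 2 = ln (2 * INR n / INR m)); last by field; lra.
have r12 : 12 <= 2 * INR n / INR m.
  apply: (Rmult_le_reg_r (INR m)) => //.
  rewrite (_ : 2 * INR n / INR m * INR m = 2 * INR n); [lra | field; lra].
apply: (Rle_trans _ (ln 12)); last by apply: ln_mono; lra.
have E1 : ln 2 * 7 = ln (2 ^ 7) by rewrite ln_pow; [rewrite /=; ring | lra].
have E2 : 2 * ln 12 = ln (12 ^ 2) by rewrite ln_pow; [rewrite /=; ring | lra].
have : ln (2 ^ 7) <= ln (12 ^ 2) by apply: ln_mono; lra.
lra.
Qed.
Let lg := l_ge.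

Lemma l_le : l <= 204 * y.
Proof.
have [l1 l2] := ln2_bounds; rewrite /l /log2.
apply: (Rmult_le_reg_r (ln 2)); first lra.
rewrite (_ : ln (2 * INR n / INR m) / ln 2 * ln 2 = ln (2 * INR n / INR m)); last by field; lra.
apply: (Rle_trans _ (ln (INR n))).
  apply: ln_mono.
    by apply: Rdiv_lt_0_compat; lra.
  apply: (Rmult_le_reg_r (INR m)) => //.
  rewrite (_ : 2 * INR n / INR m * INR m = 2 * INR n); last by field; lra.
  have : 2 <= INR m.
    rewrite m_eq_pow -[2]pow_1; apply: (Rle_trans _ (M ^ 1)); first by lra.
    by apply: Rle_pow; [lra | apply/leP].
  nra.
have := ln_n_le; nra.
Qed.

(** The factor [7 / 2] in [q] is offset by [7 / 2 <= l], which leaves [m / n <= / 6]. *)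
Lemma q_bounds : 0 < q <= / 6.
Proof.
have nl : 0 < INR n * l by apply: Rmult_lt_0_compat; lra.
split; first by apply: Rdiv_lt_0_compat; lra.
apply: (Rmult_le_reg_r (INR n * l)) => //.
rewrite (_ : q * (INR n * l) = 7 / 2 * INR m); last by rewrite /q; field; lra.
nra.
Qed.

Lemma qnl_eq : q * INR n * l = 7 / 2 * INR m.
Proof. by rewrite /q; field; lra. Qed.

Lemma Mpow_le k k' : (k <= k')%nat -> M ^ k <= M ^ k'.
Proof. by move=> /leP kk; apply: Rle_pow => //; lra. Qed.

Lemma typical_ge_half : / 2 <= typical n q (3 / 4 * (q * INR n)).
Proof.
have [q0 q6] := q_bounds.
(* Multiplied by [n * l ^ 2], the right side becomes [(q * n * l) ^ 2 = 49 / 4 * M ^ 200], while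
   [n * l ^ 2 <= M ^ 104]. *)
have qn64 : 64 <= q ^ 2 * INR n.
  apply: (Rmult_le_reg_r (INR n * l ^ 2)).
    by apply: Rmult_lt_0_compat => //; apply: pow_lt; lra.
  rewrite (_ : q ^ 2 * INR n * (INR n * l ^ 2) = (q * INR n * l) ^ 2); last by ring.
  rewrite qnl_eq.
  have l2 : l ^ 2 <= M ^ 2.
    apply: (Rle_trans _ ((204 * y) ^ 2)); first by apply: pow_incr; split; [lra | exact: l_le].
    have := M_ge_sq; nra.
  have nl : INR n * l ^ 2 <= M ^ 104.
    rewrite (_ : M ^ 104 = M ^ 102 * M ^ 2); last by rewrite -pow_add.
    by apply: Rmult_le_compat => //; [lra | exact: pow2_ge_0 | exact: n_le_pow].
  have m2 : (7 / 2 * INR m) ^ 2 = 49 / 4 * M ^ 200.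
    by rewrite m_eq_pow (_ : M ^ 200 = M ^ 100 * M ^ 100); [field | rewrite -pow_add].
  have : 64 * M ^ 104 <= M ^ 200.
    have E : M ^ 200 = M ^ 1 * M ^ 104 * M ^ 95 by rewrite -!pow_add.
    have p1 : 1 <= M ^ 95 by apply: pow_R1_Rle; lra.
    have p0 : 0 < M ^ 104 by apply: pow_lt; lra.
    rewrite E pow_1; move: (M ^ 95) (M ^ 104) p1 p0 => P Q P1 Q0.
    have MP : 64 <= M * P by nra.
    by nra.
  have : 0 < M ^ 200 by apply: pow_lt; lra.
  by rewrite m2; lra.
(* The choice [theta = q / 8] minimises the exponent [theta ^ 2 * n - theta * q * n / 4], with value
   [- q ^ 2 * n / 64]. *)
have tail := @weight_lower_tail n q (q / 8) (3 / 4 * (q * INR n)) ltac:(lra) ltac:(lra).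
have -> : typical n q (3 / 4 * (q * INR n)) =
  1 - Ex (bern q) (fun e : bv n => indR (~~ leR (3 / 4 * (q * INR n)) (weight e))).
  have one := Ex_const (bern1 q) n 1.
  rewrite -[X in _ = X - _]one /typical /Ex -RsumB; apply: eq_Rsum => e.
  by case: (leR _ _) => /=; ring.
suff : exp (q / 8 * (3 / 4 * (q * INR n) - q * INR n) + (q / 8) ^ 2 * INR n) <= / 2 by lra.
apply: Rle_trans exp_opp1_le; apply: exp_le.
by rewrite (_ : _ + _ = - (q ^ 2 * INR n / 64)); [lra | field].
Qed.

(** As [7 / 2 <= l], one has [n / m <= / q], hence [l - 1 <= log2 (/ q)]. Then [3 / 4 * q * n * (l -
    1) = 21 / 8 * m - 3 / 4 * q * n], and [q * n <= m] leaves [15 / 8 * m]. *)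
Lemma noise_entropy_ge : 1.5 * INR m <= 3 / 4 * (q * INR n) * log2 (/ q) - 1.
Proof.
have [q0 q6] := q_bounds; have [l1 l2] := ln2_bounds; have qn := qnl_eq.
have m_big : 8 <= INR m.
  rewrite m_eq_pow; apply: (Rle_trans _ (M ^ 1)); first by lra.
  by apply: Rle_pow; [lra | apply/leP].
have lq : l - 1 <= log2 (/ q).
  rewrite /l /log2; apply: (Rmult_le_reg_r (ln 2)); first lra.
  rewrite (_ : ln (/ q) / ln 2 * ln 2 = ln (/ q)); last by field; lra.
  rewrite (_ : (ln (2 * INR n / INR m) / ln 2 - 1) * ln 2 = ln (2 * INR n / INR m) - ln 2); last by field; lra.
  have nm : 0 < INR n / INR m by apply: Rdiv_lt_0_compat.
  rewrite (_ : 2 * INR n / INR m = 2 * (INR n / INR m)); last by field; lra.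
  rewrite ln_mult //; last lra.
  suff : ln (INR n / INR m) <= ln (/ q) by lra.
  apply: ln_mono => //.
  apply: (Rmult_le_reg_r q) => //; rewrite Rinv_l; last lra.
  rewrite (_ : INR n / INR m * q = 7 / 2 * / l); last by rewrite /q; field; lra.
  apply: (Rmult_le_reg_r l); first lra.
  by rewrite Rmult_assoc Rinv_l; lra.
have qn0 : 0 <= 3 / 4 * (q * INR n).
  by have := Rmult_lt_0_compat _ _ q0 n_gt0; lra.
suff : 1.5 * INR m + 1 <= 3 / 4 * (q * INR n) * (l - 1).
  have := Rmult_le_compat_l _ _ _ qn0 lq; lra.
have -> : 3 / 4 * (q * INR n) * (l - 1) = 21 / 8 * INR m - 3 / 4 * (q * INR n).
  rewrite (_ : 3 / 4 * (q * INR n) * (l - 1) = 3 / 4 * (q * INR n * l) - 3 / 4 * (q * INR n)); last by ring.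
  by rewrite qn; field.
have : q * INR n <= INR m.
  apply: (Rmult_le_reg_r l); first lra.
  by rewrite qn; nra.
lra.
Qed.

Variable h : bv n -> bv m.
Hypothesis h_sparse :
  INR (sparsity h) <= 0.001 * INR n * log2 (INR m) * log2 (2 * INR n / INR m).

Lemma log2_m_ge0 : 0 <= log2 (INR m).
Proof.
have [l1 _] := ln2_bounds; rewrite /log2; have -> : ln (INR m) = 100 * y by rewrite /y; field.
by apply: Rmult_le_pos; [lra | apply/Rlt_le/Rinv_0_lt_compat; lra].
Qed.

Lemma sparsity_le_pow : INR (sparsity h) <= M ^ 103.
Proof.
apply: Rle_trans h_sparse _; rewrite -/l.
have lm0 := log2_m_ge0.
rewrite (_ : 0.001 * INR n * log2 (INR m) * l = INR n * (0.001 * (log2 (INR m) * l))); last by ring.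
rewrite (_ : M ^ 103 = M ^ 102 * M ^ 1); last by rewrite -pow_add.
apply: Rmult_le_compat; [lra | | exact: n_le_pow |].
  by apply: Rmult_le_pos; [lra | apply: Rmult_le_pos; lra].
have : log2 (INR m) * l <= (200 * y) * (204 * y).
  by apply: Rmult_le_compat; [lra | lra | exact: log2_m_le | exact: l_le].
have := M_ge_sq; rewrite pow_1; nra.
Qed.

(** Each power is at least [exp (- 4 * q * D)] for the in-degree [D]. The sparsity bound makes the
    mean of [4 * q * D] at most [0.014 * log2 m <= 3 * y], so [sum_exp_ge] gives
    [m * exp (- 3 * y) = M ^ 97]. *)
Lemma stability_sum_ge :
  M ^ 97 <= Rsum (fun j => (1 - 2 * q) ^ (\sum_(i < n) depends h i j)%nat).
Proof.
have [q0 q6] := q_bounds.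
apply: (Rle_trans _ (INR m * exp (- (3 * y)))).
  rewrite m_eq_pow /M -!exp_pow -exp_plus; apply: exp_le.
  by rewrite !INR_IZR_INZ /=; lra.
apply: (Rle_trans _ (Rsum (fun j => exp (- (4 * q * INR (\sum_(i < n) depends h i j)%nat))))).
  apply: sum_exp_ge; rewrite RsumZ Rsum_indeg.
  apply: (Rle_trans _ (4 * q * (0.001 * INR n * log2 (INR m) * l))).
    by apply: Rmult_le_compat_l; [lra | exact: h_sparse].
  rewrite (_ : 4 * q * (0.001 * INR n * log2 (INR m) * l) = 4 * 0.001 * (q * INR n * l) * log2 (INR m)); last by ring.
  rewrite qnl_eq; have := log2_m_le; nra.
apply: Rsum_le => j; rewrite Ropp_mult_distr_l; apply: pow_ge_exp; lra.
Qed.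

(** The parameters are [Delta = M ^ 18], [lam = / M ^ 30], [theta = / (8 * M ^ 3)], [S = M ^ 97] and
    [t = S / 4]. Both error terms are at most a quarter of [exp (- M ^ 10)]; with weights 1 and 2
    they sum to three quarters of it. *)
Lemma mean_SD_large :
  1 - exp (- M ^ 10) <=
    Rsum (fun z => / 2 ^ n * SD (push h (source q (3 / 4 * (q * INR n)) z)) (@unif m)).
Proof.
have [q0 q6] := q_bounds.
have Mk k : 0 < M ^ k by apply: pow_lt; lra.
have Mk1 k : 1 <= M ^ k by apply: pow_R1_Rle; lra.
have lD : / M ^ 30 * M ^ 18 <= / 4.
  apply: (Rmult_le_reg_l (M ^ 30)) => //.
  rewrite -Rmult_assoc Rinv_r; last by have := Mk 30%nat; lra.
  rewrite (_ : M ^ 30 = M ^ 18 * M ^ 11 * M ^ 1); last by rewrite -!pow_add.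
  move: (Mk 18%nat) (Mk1 11%nat); rewrite pow_1; move: (M ^ 18) (M ^ 11) => P Q P0 Q1.
  have MQ : 4 <= Q * M by nra.
  by nra.
have th : 0 <= / (8 * M ^ 3) <= / 4.
  split; first by apply/Rlt_le/Rinv_0_lt_compat; have := Mk 3%nat; lra.
  by apply: Rinv_le_contravar; have := Mk1 3%nat; lra.
have l0 : 0 <= / M ^ 30 by apply/Rlt_le/Rinv_0_lt_compat.
have q2 : 0 < q <= / 2 by lra.
have main := mean_SD_ge (M ^ 97 / 4) (@relies_depends n m h) q2 typical_ge_half
   (Rlt_le _ _ (Mk 18%nat)) l0 lD th stability_sum_ge.
apply: Rle_trans main.
set H := heavy _ _.
have sp := sparsity_le_pow.
have cardH : INR #|H| <= M ^ 85.
  apply: (Rmult_le_reg_l (M ^ 18)) => //; rewrite -pow_add.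
  by apply: Rle_trans sp; rewrite -Rsum_outdeg; apply: card_heavy; exact: Rlt_le.
(* The exponent is [M ^ 94 / 64 - M ^ 94 / 32], which beats the factor [exp (M ^ 85)] paid for the
   guesses. *)
have gam : 2 ^ #|H| * exp ((/ (8 * M ^ 3)) ^ 2 * INR m - / (8 * M ^ 3) * (M ^ 97 / 4))
    <= exp (- M ^ 10) * / 4.
  apply: (Rle_trans _ (exp (M ^ 85) * exp (- (M ^ 94 / 64)))).
    apply: Rmult_le_compat; [by apply: pow_le; lra | exact/Rlt_le/exp_pos | | ].
      rewrite -[2]exp_ln; last lra.
      rewrite -exp_pow; apply: exp_le; have [l1 l2] := ln2_bounds.
      have := pos_INR #|H|; nra.
    apply: exp_le; rewrite m_eq_pow.
    rewrite (_ : M ^ 100 = M ^ 3 * M ^ 3 * M ^ 94); last by rewrite -!pow_add.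
    rewrite (_ : M ^ 97 = M ^ 3 * M ^ 94); last by rewrite -!pow_add.
    by apply: Req_le; field; have := Mk 3%nat; lra.
  apply: (Rle_trans _ (exp (- M ^ 10) * exp (- (1) + - (1)))).
    rewrite -!exp_plus; apply: exp_le.
    have E : M ^ 94 = M ^ 85 * (M ^ 8 * M ^ 1) by rewrite -!pow_add.
    move: (@Mpow_le 10 85 isT) (Mk1 85%nat) (Mk1 8%nat).
    rewrite E pow_1; move: (M ^ 10) (M ^ 85) (M ^ 8) => P Q Z PQ Q1 Z1.
    have ZM : 2001 <= Z * M by nra.
    by nra.
  apply: Rmult_le_compat_l; first exact/Rlt_le/exp_pos.
  by rewrite exp_plus; have := exp_opp1_le; have := exp_pos (- (1)); nra.
(* The gain is [M ^ 97 / 4] over [M ^ 30]; the variance term is at most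
   [2 * M ^ (18 + 103 - 60) = 2 * M ^ 61]. *)
have bet : exp (- / M ^ 30 * (M ^ 97 / 2 - M ^ 97 / 4)
     + 2 * (/ M ^ 30) ^ 2 * (M ^ 18 * Rsum (outdeg (depends h)))) <= exp (- M ^ 10) * / 4.
  apply: (Rle_trans _ (exp (- M ^ 10) * exp (- (1) + - (1)))).
    rewrite -!exp_plus; apply: exp_le.
    apply: (Rle_trans _ (- (M ^ 67 / 4) + 2 * M ^ 61)).
      apply: Rplus_le_compat.
        rewrite (_ : M ^ 97 = M ^ 30 * M ^ 67); last by rewrite -!pow_add.
        by apply: Req_le; field; have := Mk 30%nat; lra.
      rewrite Rsum_outdeg Rmult_assoc; apply: Rmult_le_compat_l; first lra.
      apply: (Rmult_le_reg_l (M ^ 30 * M ^ 30)); first exact: Rmult_lt_0_compat.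
      rewrite (_ : M ^ 30 * M ^ 30 * ((/ M ^ 30) ^ 2 * (M ^ 18 * INR (sparsity h)))
         = M ^ 18 * INR (sparsity h)); last by field; have := Mk 30%nat; lra.
      rewrite -!pow_add (_ : M ^ (30 + 30 + 61) = M ^ 18 * M ^ 103); last by rewrite -pow_add.
      by apply: Rmult_le_compat_l; [exact: Rlt_le|].
    have E : M ^ 67 = M ^ 61 * (M ^ 5 * M ^ 1) by rewrite -!pow_add.
    move: (@Mpow_le 10 61 isT) (Mk1 61%nat) (Mk1 5%nat).
    rewrite E pow_1; move: (M ^ 10) (M ^ 61) (M ^ 5) => P Q Z PQ Q1 Z1.
    have ZM : 2001 <= Z * M by nra.
    by nra.
  apply: Rmult_le_compat_l; first exact/Rlt_le/exp_pos.
  by rewrite exp_plus; have := exp_opp1_le; have := exp_pos (- (1)); nra.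
have := exp_pos (- M ^ 10); lra.
Qed.

End Calibration.

(** * The finite family of sources and the choice of constants *)

Lemma Rsum_enum_val (T : finType) (f : T -> R) :
  Rsum (fun k : 'I_#|T| => f (enum_val k)) = Rsum f.
Proof. by rewrite /Rsum (big_enum_val f). Qed.

Local Close Scope R_scope.

(* The distribution D over distributions is given with finite support:
   weights w on 'I_K and distributions X k on {0,1}^n. *)
Theorem theorem2 :
  exists c : R, (0 < c)%R /\
  exists n0 : nat,
  forall n m : nat, (n0 <= n)%N ->
    (Rpower (INR n) 0.99 <= INR m)%R -> (INR m <= INR n / 6)%R ->
    exists (K : nat) (w : 'I_K -> R) (X : 'I_K -> bv n -> R),
      is_dist w /\
      (forall k, is_dist (X k) /\ min_entropy_ge (X k) (1.5 * INR m)%R) /\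
      forall h : bv n -> bv m,
        (INR (sparsity h) <= 0.001 * INR n * log2 (INR m) * log2 (2 * INR n / INR m))%R ->
        (1 - exp (- Rpower (INR m) c) <=
           Rsum (fun k => w k * SD (push h (X k)) (@unif m)))%R.
Proof.
Local Open Scope R_scope.
(* With [M = m^0.01], the calibrated error [exp (- M ^ 10)] is [exp (- m^0.1)]. *)
exists (/ 10); split; first lra.
(* The threshold makes [ln n] at least 210000, hence [y >= 2000] in the calibration. *)
have [n0 n0P] := INR_unbounded (exp 210000).
exists n0 => n m n0n m_ge m_le.
have n_exp : exp 210000 <= INR n.
  by apply: Rle_trans (le_INR _ _ (elimT leP n0n)); lra.
have n_gt0 : 0 < INR n by apply: Rlt_le_trans (exp_pos _) n_exp.
have n_large : 210000 <= ln (INR n).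
  by rewrite -[X in X <= _]ln_exp; apply: ln_mono n_exp; apply: exp_pos.
pose q := 7 / 2 * INR m / (INR n * log2 (2 * INR n / INR m)).
pose a := 3 / 4 * (q * INR n).
have typ := typical_ge_half n_large n_gt0 m_ge m_le; rewrite -/q -/a in typ.
have [q0 q6] := q_bounds n_gt0 m_ge m_le; rewrite -/q in q0 q6.
have q1 : 0 < q <= 1 by lra.
(* The family is indexed by the shifts [z], enumerated through [enum_val] and weighted uniformly. *)
exists #|bv n|, (fun=> / 2 ^ n), (fun k => source q a (enum_val k)).
split; last split=> [k|h h_sparse].
- split=> [k|]; first by apply/Rlt_le/Rinv_0_lt_compat/pow_lt; lra.
  rewrite (Rsum_enum_val (fun _ : bv n => / 2 ^ n)) -[RHS](Ex_const (bern1 (/ 2)) n 1) Ex_fair.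
  by apply: eq_Rsum => z; rewrite Rmult_1_r.
- split; first exact: source_dist.
  by apply: source_min_entropy => //; apply: noise_entropy_ge.
- rewrite (Rsum_enum_val (fun z => / 2 ^ n * SD (push h (source q a z)) (@unif m))).
  have -> : Rpower (INR m) (/ 10) = exp (ln (INR m) / 100) ^ 10.
    by rewrite -exp_pow /Rpower INR_IZR_INZ; congr exp; rewrite /=; field.
  exact: mean_SD_large.
Qed.
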